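(* Let $C$ be a bivariate copula and let $f,g:[0,1]\to\mathbb{R}$ satisfy conditions (G1), (G2), (G3) (recalled in the context), with associated numbers $\alpha,\beta\in[0,1]$. Then the limit $\lim_{n\to\infty}(T^\sigma_{f,g})^{(n)}(C^\sigma)(u,v)$ exists for every $(u,v)\in[0,1]^2$, and it equals: (NE corner) $C^\sigma(u,v)$ if $u\ge\alpha$ and $v\ge\beta$; (SE corner) $\dfrac{v}{\beta}\,C^\sigma(u,\beta)$ if $u\ge\alpha$ and $v\le\beta$; (NW corner) $\dfrac{u}{\alpha}\,C^\sigma(\alpha,v)$ if $u\le\alpha$ and $v\ge\beta$; (SW corner) if $u\le\alpha$ and $v\le\beta$: $$uv\,\frac{C^\sigma(\alpha,\beta)}{\alpha\beta}\prod_{k=0}^{\infty}\Bigl(1-f^*(\widehat f^{(k)}(u))\,g^*(\widehat g^{(k)}(v))\Bigr)$$ when $f(u)g(v)<uv$ (and in this case the infinite product always converges), and $0$ when $f(u)g(v)\ge uv$.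
   Context: For a bivariate copula $C$, the flip is the copula $C^\sigma(u,v)=u-C(u,1-v)$. For $f,g:[0,1]\to\mathbb{R}$ put $f^*(u)=f(u)/u$, $g^*(v)=g(v)/v$ for $u,v\in(0,1]$, and $\widehat f(u)=u+f(u)$, $\widehat g(v)=v+g(v)$. Conditions: (G1) $f(0)=g(0)=0$, $f(1)=g(1)=0$, $f^*(1)=g^*(1)=0$; (G2) $\widehat f,\widehat g$ are nondecreasing on $[0,1]$; (G3) $f^*,g^*$ are nonincreasing on $(0,1]$. The reflected maxmin transformation is the map on copulas $$T^\sigma_{f,g}(D)(u,v)=uv\,\frac{D(\widehat f(u),\widehat g(v))}{\widehat f(u)\widehat g(v)}\max\{0,1-f^*(u)g^*(v)\},$$ and $(T^\sigma_{f,g})^{(n)}=T^\sigma_{f,g}\circ (T^\sigma_{f,g})^{(n-1)}$ denotes its $n$-th iterate. With $\widehat f^{(k)},\widehat g^{(k)}$ denoting $k$-fold compositions ($\widehat f^{(0)}=\widehat g^{(0)}=\mathrm{id}$), explicitly $$(T^\sigma_{f,g})^{(n)}(C^\sigma)(u,v)=uv\,\frac{C^\sigma(\widehat f^{(n)}(u),\widehat g^{(n)}(v))}{\widehat f^{(n)}(u)\,\widehat g^{(n)}(v)}\prod_{k=0}^{n-1}\max\{0,1-f^*(\widehat f^{(k)}(u))g^*(\widehat g^{(k)}(v))\}.$$ All these expressions, as well as the ones for the limit, are read as $0$ when $u=0$ or $v=0$. $\alpha$ is the smallest number in $[0,1]$ such that $\widehat f(x)=x$ for all $x\in[\alpha,1]$;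 $\beta$ is the smallest number in $[0,1]$ such that $\widehat g(x)=x$ for all $x\in[\beta,1]$. Convergence of an infinite product of positive factors means that the partial products converge to a nonzero limit. *)

(* Defs.v *)
From HB Require Import structures.
From mathcomp Require Import all_boot all_order all_algebra.
From mathcomp Require Import all_classical all_reals all_analysis.

Set Implicit Arguments.
Unset Strict Implicit.
Unset Printing Implicit Defensive.

Import Order.TTheory GRing.Theory Num.Theory.
Import numFieldNormedType.Exports.

Local Open Scope classical_set_scope.
Local Open Scope ring_scope.

(* Functions on [0,1] and [0,1]^2 are represented by total functions; their
   values outside the unit interval or square are left unconstrained and are
   never used at arguments inside it. *)

Definition copula (R : realType) (C : R -> R -> R) : Prop :=
  [/\ forall u, u \in `[0, 1] -> C u 0 = 0 /\ C 0 u = 0,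
      forall u, u \in `[0, 1] -> C u 1 = u /\ C 1 u = u
    & forall u1 u2 v1 v2,
        u1 \in `[0, 1] -> u2 \in `[0, 1] -> v1 \in `[0, 1] -> v2 \in `[0, 1] ->
        u1 <= u2 -> v1 <= v2 ->
        0 <= C u2 v2 - C u1 v2 - C u2 v1 + C u1 v1].

Definition flip (R : realType) (C : R -> R -> R) : R -> R -> R :=
  fun u v => u - C u (1 - v).

Definition star (R : realType) (f : R -> R) : R -> R := fun u => f u / u.

Definition hat (R : realType) (f : R -> R) : R -> R := fun u => u + f u.

(* The conditions (G1), (G2), (G3) on one of the two functions. *)
Definition generator (R : realType) (f : R -> R) : Prop :=
  [/\ [/\ f 0 = 0, f 1 = 0 & star f 1 = 0],
      {in `[0, 1] &, {homo hat f : x y / x <= y}}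
    & {in `]0, 1] &, {homo star f : x y /~ x <= y}}].

(* Since x / 0 = 0 and because of the factor u * v, the right-hand side is 0
   when u = 0 or v = 0, as required. *)
Definition reflected_maxmin (R : realType) (f g : R -> R) (D : R -> R -> R) :
    R -> R -> R :=
  fun u v => u * v * (D (hat f u) (hat g v) / (hat f u * hat g v))
             * Num.max 0 (1 - star f u * star g v).

Definition least (R : realType) (A : set R) (a : R) : Prop := A a /\ lbound A a.

Definition fixes_above (R : realType) (f : R -> R) : set R :=
  [set a | a \in `[0, 1] /\ forall x, x \in `[a, 1] -> hat f x = x].

Lemma least_fixes_above (R : realType) (f : R -> R) :
  generator f -> exists a, least (fixes_above f) a.
Proof.
case=> -[f0 f1 fs1] fhom fanti; set S := fixes_above f.
have S1 : S 1.
  split; first by rewrite in_itv /= ler01 lexx.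
  by move=> x; rewrite in_itv /= -eq_le => /eqP <-; rewrite /hat f1 addr0.
have lb0 : lbound S 0 by move=> x [] /[!in_itv] /= /andP[].
have lbS : lbound S (inf S) by apply: ge_inf; exists 0.
have i0 : 0 <= inf S by apply: lb_le_inf => //; exists 1.
have fix_gt x : inf S < x -> x <= 1 -> hat f x = x.
  move=> ix x1; have [|s [_ sS] sx] := inf_lt _ ix; first by exists 1.
  by apply: sS; rewrite in_itv /= (ltW sx).
exists (inf S); split => //; split; first by rewrite in_itv /= i0 lbS.
move=> x; rewrite in_itv /= => /andP[]; rewrite le_eqVlt => /predU1P[<- i1|].
  have [->|ineq0] := eqVneq (inf S) 0; first by rewrite /hat f0 addr0.
  have igt0 : 0 < inf S by rewrite lt_neqAle eq_sym ineq0.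
  apply/eqP; rewrite eq_le; apply/andP; split; last first.
    have : star f 1 <= star f (inf S).
      by apply: fanti => //; rewrite in_itv /= ?igt0 ?i1 ?ltr01 ?lexx.
    by rewrite fs1 /star /hat lerDl pmulr_lge0 ?invr_gt0.
  move: i1; rewrite le_eqVlt => /predU1P[->|i1].
    by rewrite /hat f1 addr0.
  rewrite leNgt; apply/negP => ih.
  have [y iy /andP[yh y1]] : exists2 y, inf S < y & (y < hat f (inf S)) && (y <= 1).
    have im : inf S < Num.min (hat f (inf S)) 1 by rewrite lt_min ih.
    have [m1 m2] := midf_lt im.
    exists ((inf S + Num.min (hat f (inf S)) 1) / 2%:R) => //.
    by move: m2; rewrite lt_min => /andP[-> /ltW ->].
  have : hat f (inf S) <= hat f y.
    apply: fhom; last exact: ltW.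
      by rewrite in_itv /= i0 ltW.
    by rewrite in_itv /= y1 (le_trans i0 (ltW iy)).
  by rewrite (fix_gt y)// leNgt yh.
by move=> ix x1; apply: fix_gt.
Qed.

(* The factors are meant to be positive; convergence to 0 does not count. *)
Definition infinite_product (R : realType) (a : nat -> R) (p : R) : Prop :=
  p != 0 /\ \prod_(k < n) a k @[n --> \oo] --> p.

(* Main.v *)
Require Import Defs.
From HB Require Import structures.
From mathcomp Require Import all_boot all_order all_algebra.
From mathcomp Require Import all_classical all_reals all_analysis.
From mathcomp Require Import ring lra.

(** The iterate at [(u, v)] is a quotient of values of the flipped copula along
    the orbits [u_k], [v_k] of [hat f] and [hat g], times the partial product
    of [1 - a_k] with [a_k = star f u_k * star g v_k] ([iter_reflected_maxmin]).
    Both pieces converge for elementary reasons.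

    The orbits: [hat f] lies above the identity, is nondecreasing, and
    [hat f x / x] is nonincreasing, so it is continuous on [(0, 1]].  An orbit
    increases to a fixed point, and since [star f] is nonnegative and
    nonincreasing, every point above a fixed point is fixed as well.  Hence an
    orbit that starts in [(0, alpha]] converges to [alpha]
    ([orbit_cvg]).  The flip of a copula is a copula, and a copula is
    1-Lipschitz in each variable, so the quotient converges
    ([flip_copula], [copula_cvg]).

    The product: [a_k] is nonincreasing, so when [a_0 < 1] all the factors are
    positive and the partial products decrease.  They stay away from 0
    because [1 + star f u_k = u_(k+1) / u_k] telescopes: for a large integer
    [M], Bernoulli's inequality gives [(1 - a_k) * (1 + star f u_k) ^+ M >= 1],
    so the partial products are at least [u ^+ M]
    ([orbit_prod_ge], [orbit_prod_cvg]).  When [a_0 >= 1], the truncated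
    factor of index 0 vanishes, and so do all iterates of order at least 1.

    If [u >= alpha] or [v >= beta], one of the starting points is already
    fixed, so all the [a_k] vanish and the product is 1.  Points with
    [u * v = 0] are separate: the factor [u * v] makes the iterates vanish
    there, and the boundary values of a copula give the same limit. *)

Set Implicit Arguments.
Unset Strict Implicit.

Import Order.TTheory GRing.Theory Num.Theory.
Import numFieldNormedType.Exports.

Local Open Scope classical_set_scope.
Local Open Scope ring_scope.

(** * Copulas *)

(** The reflection [v -> 1 - v] reverses the rectangles, and the minus sign in
    front of [C] restores the sign of their mass. *)
Lemma flip_copula (R : realType) (C : R -> R -> R) :
  copula C -> copula (flip C).
Proof.
case=> C0 C1 Cinc.
have rev (x : R) : x \in `[0, 1] -> 1 - x \in `[0, 1].
  by rewrite !in_itv /= => /andP[x0 x1]; apply/andP; split; lra.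
have i0 : (0 : R) \in `[0, 1] by rewrite in_itv /= lexx ler01.
have i1 : (1 : R) \in `[0, 1] by rewrite in_itv /= lexx ler01.
rewrite /flip; split=> [u hu|u hu|u1 u2 v1 v2 hu1 hu2 hv1 hv2 hu hv].
- by rewrite subr0 (C1 _ hu).1 subrr (C0 _ (rev _ hu)).2 subr0.
- by rewrite subrr (C0 _ hu).1 subr0 (C1 _ (rev _ hu)).2 opprB addrC subrK.
have v21 : 1 - v2 <= 1 - v1 by rewrite lerD2l lerN2.
by move: (Cinc _ _ _ _ hu1 hu2 (rev _ hv2) (rev _ hv1) hu v21); lra.
Qed.

Lemma copula_lipschitz (R : realType) (C : R -> R -> R) (x y a b : R) :
  copula C -> 0 <= x -> x <= a -> a <= 1 -> 0 <= y -> y <= b -> b <= 1 ->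
  0 <= C a b - C x y <= (a - x) + (b - y).
Proof.
move=> [C0 C1 Cinc] x0 xa a1 y0 yb b1.
have ix : x \in `[0, 1] by rewrite in_itv /= x0 (le_trans xa).
have ia : a \in `[0, 1] by rewrite in_itv /= a1 (le_trans x0).
have iy : y \in `[0, 1] by rewrite in_itv /= y0 (le_trans yb).
have ib : b \in `[0, 1] by rewrite in_itv /= b1 (le_trans y0).
have i0 : (0 : R) \in `[0, 1] by rewrite in_itv /= lexx ler01.
have i1 : (1 : R) \in `[0, 1] by rewrite in_itv /= lexx ler01.
have [_ b0] := andP ib; have [a0 _] := andP ia.
(* Four rectangles: two touching the axes give monotonicity, two touching the
   sides of equation 1 give the Lipschitz bounds. *)
have := Cinc _ _ _ _ ix ia iy i1 xa (le_trans yb b1).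
have := Cinc _ _ _ _ ix ia i0 iy xa y0.
have := Cinc _ _ _ _ i0 ia iy ib (le_trans x0 xa) yb.
have := Cinc _ _ _ _ ia i1 iy ib a1 yb.
rewrite (C0 _ ix).1 (C0 _ ia).1 (C0 _ iy).2 (C0 _ ib).2.
rewrite (C1 _ ix).1 (C1 _ ia).1 (C1 _ iy).2 (C1 _ ib).2.
by move=> *; apply/andP; split; lra.
Qed.

(** Sequences that approach their limits from below suffice for orbits, and
    they allow a one-sided squeeze. *)
Lemma copula_cvg (R : realType) (C : R -> R -> R) (x y : nat -> R) (a b : R) :
  copula C -> a <= 1 -> b <= 1 ->
  (forall n, 0 <= x n <= a) -> (forall n, 0 <= y n <= b) ->
  x n @[n --> \oo] --> a -> y n @[n --> \oo] --> b ->
  C (x n) (y n) @[n --> \oo] --> C a b.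
Proof.
move=> cC a1 b1 hx hy cx cy.
apply: (@squeeze_cvgr _ _ _ _
  (fun n => C a b - ((a - x n) + (b - y n))) (fun=> C a b)).
- near=> n.
  have /andP[x0 xa] := hx n; have /andP[y0 yb] := hy n.
  have /andP[L U] := copula_lipschitz cC x0 xa a1 y0 yb b1.
  by apply/andP; split; lra.
- rewrite [X in _ --> X](_ : _ = C a b - ((a - a) + (b - b))); last lra.
  apply: cvgB; first exact: cvg_cst.
  by apply: cvgD; apply: cvgB => //; exact: cvg_cst.
- exact: cvg_cst.
Unshelve. all: by end_near. Qed.

(** * Orbits of a generator *)

Section Generator.
Variables (R : realType) (f : R -> R) (alpha : R).
Hypotheses (hf : generator f) (halpha : least (fixes_above f) alpha).

Let orbit (u : R) (n : nat) : R := iter n (hat f) u.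

Lemma star_ge0 (u : R) : 0 < u <= 1 -> 0 <= star f u.
Proof.
case: hf => -[_ _ s1] _ fanti /andP[u0 u1]; rewrite -s1.
by apply: fanti => //; rewrite in_itv /= ?u0 ?ltr01 ?lexx.
Qed.

Lemma hatE (u : R) : 0 < u -> hat f u = u * (1 + star f u).
Proof. by move=> u0; rewrite /star /hat mulrDr mulr1 mulrC divfK ?gt_eqF. Qed.

Lemma le_hat (u : R) : 0 < u <= 1 -> u <= hat f u.
Proof.
move=> u01; have /andP[u0 _] := u01.
by rewrite hatE// ler_peMr ?(ltW u0)// lerDl star_ge0.
Qed.

Lemma hat_le1 (u : R) : 0 < u <= 1 -> hat f u <= 1.
Proof.
case: hf => -[_ f1 _] fhom _ /andP[u0 u1].
have <- : hat f 1 = 1 by rewrite /hat f1 addr0.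
by apply: fhom => //; rewrite in_itv /= ?u1 ?(ltW u0) ?lexx ?ler01.
Qed.

Lemma hat_itv (u : R) : 0 < u <= 1 -> 0 < hat f u <= 1.
Proof.
move=> u01; rewrite hat_le1// andbT (lt_le_trans _ (le_hat u01))//.
by case/andP: u01.
Qed.

Lemma orbit_itv (u : R) (n : nat) : 0 < u <= 1 -> 0 < orbit u n <= 1.
Proof. by move=> u01; elim: n => //= n; exact: hat_itv. Qed.

Lemma orbit_homo (u : R) : 0 < u <= 1 ->
  {homo orbit u : m n / (m <= n)%N >-> m <= n}.
Proof.
by move=> u01; apply/nondecreasing_seqP => n; exact/le_hat/orbit_itv.
Qed.

Lemma star_orbit_le (u : R) (n : nat) : 0 < u <= 1 ->
  star f (orbit u n) <= star f u.
Proof.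
move=> u01; case: hf => _ _ fanti; apply: fanti.
- by rewrite in_itv /= orbit_itv.
- by rewrite in_itv.
- exact: (orbit_homo u01 (leq0n n)).
Qed.

Lemma hat_alpha (u : R) : alpha <= u <= 1 -> hat f u = u.
Proof. by move=> hu; case: halpha => -[_ h] _; apply: h. Qed.

Lemma star_alpha (u : R) : alpha <= u <= 1 -> star f u = 0.
Proof.
move=> /hat_alpha; rewrite /hat /star => /(canRL (addKr _)) ->.
by rewrite addNr mul0r.
Qed.

Lemma orbit_alpha (u : R) (n : nat) : alpha <= u <= 1 -> orbit u n = u.
Proof.
by move=> hu; elim: n => //= n; rewrite /orbit /= => ->; exact: hat_alpha.
Qed.

Lemma alpha_le1 : alpha <= 1.
Proof. by case: halpha => -[] /[!in_itv] /= /andP[]. Qed.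

(** The assumption makes [l] a fixed point, since [hat f] lies above the
    identity.  Then [star f], nonnegative and nonincreasing, vanishes from [l]
    on, and [alpha] is the least such point. *)
Lemma alpha_le_fixed (l : R) : 0 < l <= 1 -> hat f l <= l -> alpha <= l.
Proof.
move=> l01 hl; have /andP[l0 l1] := l01.
case: halpha => _; apply; split; first by rewrite in_itv /= l1 ltW.
move=> x /[!in_itv] /= /andP[lx x1].
have x01 : 0 < x <= 1 by rewrite x1 (lt_le_trans l0).
have /andP[x0 _] := x01.
have sl : star f l <= 0.
  by move: hl; rewrite /hat -[leRHS]addr0 lerD2l /star pmulr_lle0 ?invr_gt0.
have sx : star f x = 0.
  apply/eqP; rewrite eq_le star_ge0// andbT; apply: le_trans sl.
  by case: hf => _ _ fanti; apply: fanti; rewrite // in_itv.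
by rewrite hatE// sx addr0 mulr1.
Qed.

Lemma orbit_le_alpha (u : R) (n : nat) : 0 < u <= 1 -> u <= alpha ->
  orbit u n <= alpha.
Proof.
move=> u01 ua; elim: n => // n IH; rewrite /orbit iterS -/(orbit u n).
have /andP[w0 _] := orbit_itv n u01.
have ha : hat f alpha = alpha by rewrite hat_alpha// lexx alpha_le1.
rewrite -[leRHS]ha.
by case: hf => _ fhom _; apply: fhom;
  rewrite // in_itv /= ?(ltW w0) ?alpha_le1 ?(le_trans IH alpha_le1)
     ?(le_trans (ltW w0) IH).
Qed.

(** The limit exists by monotonicity, and it is a fixed point because [hat f]
    is continuous away from 0. *)
Lemma orbit_cvg (u : R) : 0 < u <= 1 -> u <= alpha ->
  orbit u n @[n --> \oo] --> alpha.
Proof.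
move=> u01 ua; have /andP[u0 u1] := u01.
have homo := orbit_homo u01.
have cvl : cvgn (orbit u).
  apply: nondecreasing_is_cvgn => //; exists alpha => _ [n _ <-].
  exact: orbit_le_alpha.
have ol n : orbit u n <= limn (orbit u) by exact: nondecreasing_cvgn_le.
set l := limn (orbit u) in ol.
have la : l <= alpha.
  by apply: limr_le => //; near=> n; exact: orbit_le_alpha.
have l0 : 0 < l by apply: lt_le_trans u0 (ol 0).
have l01 : 0 < l <= 1 by rewrite l0 (le_trans la alpha_le1).
suff /alpha_le_fixed al : hat f l <= l.
  have <- : l = alpha by apply/eqP; rewrite eq_le la al.
  exact: cvl.
(* Pass to the limit in [u_n * hat f l <= l * hat f u_n = l * u_(n+1)], an
   instance of the monotonicity of [hat f x / x = 1 + star f x]. *)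
rewrite -(ler_pM2l l0).
apply: (@ler_cvg_to _ \oo _ R (fun n => orbit u n * hat f l)
  (fun n => l * orbit u n.+1)).
- by apply: cvgM; [exact: cvl|exact: cvg_cst].
- by apply: cvgM; [exact: cvg_cst|rewrite (cvg_shiftS (orbit u)); exact: cvl].
- near=> n; rewrite /orbit iterS -/(orbit u n).
  have w01 := orbit_itv n u01; have /andP[w0 _] := w01.
  rewrite !hatE// mulrCA ler_pM2l// ler_pM2l// lerD2l.
  by case: hf => _ _ fanti; apply: fanti; rewrite ?in_itv.
Unshelve. all: by end_near. Qed.

End Generator.

(** * The infinite product *)

Lemma bernoulli_ineq (R : realDomainType) (x : R) (n : nat) :
  0 <= x -> 1 + n%:R * x <= (1 + x) ^+ n.
Proof.
move=> x0; elim: n => [|n IH]; first by rewrite mul0r addr0 expr0.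
rewrite exprS; apply: (@le_trans _ _ ((1 + x) * (1 + n%:R * x))).
  have : 0 <= n%:R * x * x by rewrite !mulr_ge0.
  by rewrite -natr1; lra.
by rewrite ler_pM2l// ltr_pwDl.
Qed.

Lemma infinite_product_1 (R : realType) (b : nat -> R) :
  (forall k, b k = 1) -> infinite_product b 1.
Proof.
move=> b1; split; first exact: oner_neq0.
by apply: cvg_near_cst; near=> n; rewrite big1.
Unshelve. all: by end_near. Qed.

Section Product.
Variables (R : realType) (f g : R -> R) (u v : R).
Hypotheses (hf : generator f) (hg : generator g).
Hypotheses (hu : 0 < u <= 1) (hv : 0 < v <= 1).

Let a (k : nat) : R :=
  star f (iter k (hat f) u) * star g (iter k (hat g) v).

Lemma orbit_factor_ge0 (k : nat) : 0 <= a k.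
Proof. by rewrite mulr_ge0// star_ge0// orbit_itv. Qed.

Lemma orbit_factor_le (k : nat) : a k <= star f u * star g v.
Proof.
by rewrite ler_pM ?star_orbit_le// star_ge0// orbit_itv.
Qed.

(** Only the [star f u_k] telescope: the factors [star g v_k] are merely
    bounded by [star g v], which is absorbed in the exponent [M]. *)
Lemma orbit_prod_ge : star f u * star g v < 1 ->
  exists M, forall n, u ^+ M <= \prod_(k < n) (1 - a k).
Proof.
set q := star f u * star g v => q1.
have g0 : 0 <= star g v by exact: star_ge0.
have q1' : 0 < 1 - q by rewrite subr_gt0.
pose M := Num.bound (star g v / (1 - q)); exists M.
have gM : star g v <= M%:R * (1 - q).
  by rewrite -ler_pdivrMr// ltW// archi_boundP// divr_ge0// ltW.
(* With [x], [y] the two factors of [a k], Bernoulli reduces this to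
   [(1 - x y) (1 + M x) >= 1], that is [x (M (1 - x y) - y) >= 0], which holds
   because [M (1 - x y) >= M (1 - q) >= star g v >= y]. *)
have step k : 1 <= (1 - a k) * (1 + star f (iter k (hat f) u)) ^+ M.
  have x0 : 0 <= star f (iter k (hat f) u) by rewrite star_ge0// orbit_itv.
  have aq := orbit_factor_le k.
  have yg : star g (iter k (hat g) v) <= star g v by exact: star_orbit_le.
  apply: (@le_trans _ _ ((1 - a k) * (1 + M%:R * star f (iter k (hat f) u)))).
    move: x0 aq yg; rewrite /a -/q; set x := star f _; set y := star g _.
    move=> x0 aq yg.
    have M0 : 0 <= M%:R * (q - x * y) by rewrite mulr_ge0// subr_ge0.
    have : 0 <= x * (M%:R * (1 - x * y) - y) by rewrite mulr_ge0//; lra.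
    lra.
  rewrite ler_wpM2l ?bernoulli_ineq// subr_ge0.
  exact: le_trans aq (ltW q1).
(* Carrying the telescoped power of the current orbit point makes the bound
   inductive. *)
have main n : u ^+ M <= \prod_(k < n) (1 - a k) * iter n (hat f) u ^+ M.
  elim: n => [|n IH]; first by rewrite big_ord0 mul1r.
  have /andP[w0 _] := orbit_itv hf n hu.
  rewrite big_ord_recr iterS (hatE _ w0) exprMn.
  apply: (le_trans IH); rewrite mulrACA ler_peMr// mulr_ge0//.
    apply: prodr_ge0 => k _.
    by rewrite subr_ge0 (le_trans (orbit_factor_le k))// ltW.
  by rewrite exprn_ge0// ltW.
move=> n; apply: (le_trans (main n)).
have /andP[w0 w1] := orbit_itv hf n hu.
rewrite ler_piMr ?exprn_ile1 ?(ltW w0)//.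
apply: prodr_ge0 => k _.
by rewrite subr_ge0 (le_trans (orbit_factor_le k))// ltW.
Qed.

Lemma orbit_prod_cvg : star f u * star g v < 1 ->
  exists p, infinite_product (fun k => 1 - a k) p.
Proof.
move=> q1; have [M lb] := orbit_prod_ge q1; have /andP[u0 _] := hu.
pose P n := \prod_(k < n) (1 - a k).
have cvg : cvgn P.
  apply: nonincreasing_is_cvgn.
    apply/nonincreasing_seqP => n; rewrite /P big_ord_recr /= ler_piMr//.
      by rewrite (le_trans _ (lb n))// exprn_ge0// ltW.
    by rewrite gerBl orbit_factor_ge0.
  by exists (u ^+ M) => _ [n _ <-]; exact: lb.
exists (limn P); split; last exact: cvg.
rewrite gt_eqF// (lt_le_trans (exprn_gt0 M u0))//.
by apply: limr_ge => //; near=> n; exact: lb.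
Unshelve. all: by end_near. Qed.

End Product.

(** * The iterates of the transformation *)

(** The denominator that one application introduces cancels the factor
    [u * v] of the next one, so that a single quotient survives. *)
Lemma iter_reflected_maxmin (R : realType) (f g : R -> R) (D : R -> R -> R)
    (n : nat) (u v : R) : generator f -> generator g ->
    0 < u <= 1 -> 0 < v <= 1 ->
  iter n (reflected_maxmin f g) D u v =
  u * v * (D (iter n (hat f) u) (iter n (hat g) v)
           / (iter n (hat f) u * iter n (hat g) v))
  * \prod_(k < n)
      Num.max 0 (1 - star f (iter k (hat f) u) * star g (iter k (hat g) v)).
Proof.
move=> hf hg; elim: n u v => [|n IH] u v hu hv.
  have /andP[u0 _] := hu; have /andP[v0 _] := hv.
  by rewrite big_ord0 mulr1 mulrC divfK// mulf_neq0// gt_eqF.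
have hu' := hat_itv hf hu; have hv' := hat_itv hg hv.
have /andP[u0 _] := hu'; have /andP[v0 _] := hv'.
rewrite iterS {1}/reflected_maxmin IH// big_ord_recl.
under eq_bigr do rewrite -!iterSr.
rewrite -!iterSr /=.
set P := \prod_(_ < _) _; set Q := _ / (hat f (iter n _ _) * _).
by field; rewrite !gt_eqF.
Qed.

(** The three limits [a], [b] and [p] stay parameters so that the four corners
    are instances: [a] is [alpha] or [u], [b] is [beta] or [v], and [p] is 1
    as soon as one of the orbits is constant. *)
Lemma iter_reflected_maxmin_cvg (R : realType) (f g : R -> R)
    (D : R -> R -> R) (u v a b p : R) : generator f -> generator g ->
    copula D -> 0 < u <= 1 -> 0 < v <= 1 -> a <= 1 -> b <= 1 ->
    star f u * star g v < 1 ->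
    (forall n, iter n (hat f) u <= a) -> (forall n, iter n (hat g) v <= b) ->
    iter n (hat f) u @[n --> \oo] --> a ->
    iter n (hat g) v @[n --> \oo] --> b ->
    infinite_product (fun k => 1 - star f (iter k (hat f) u)
                                   * star g (iter k (hat g) v)) p ->
  iter n (reflected_maxmin f g) D u v @[n --> \oo]
    --> u * v * (D a b / (a * b)) * p.
Proof.
move=> hf hg hD hu hv a1 b1 q1 oa ob ca cb [_ cp].
have a0 : a != 0.
  by case/andP: hu => u0 _; rewrite gt_eqF// (lt_le_trans u0 (oa 0%N)).
have b0 : b != 0.
  by case/andP: hv => v0 _; rewrite gt_eqF// (lt_le_trans v0 (ob 0%N)).
under eq_fun => n.
  rewrite iter_reflected_maxmin//.
  under [in X in _ * X]eq_bigr => k _.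
    rewrite max_r; last by
      rewrite subr_ge0 (le_trans (orbit_factor_le hf hg hu hv k))// ltW.
    over.
  over.
apply: cvgM; last exact: cp.
apply: cvgM; first exact: cvg_cst.
apply: cvgM; last by apply: cvgV; [rewrite mulf_neq0|exact: cvgM].
apply: copula_cvg => // n; rewrite ?oa ?ob andbT ltW//.
  by case/andP: (orbit_itv hf n hu).
by case/andP: (orbit_itv hg n hv).
Qed.

Lemma iter_reflected_maxmin_axis (R : realType) (f g : R -> R)
    (D : R -> R -> R) (u v : R) : u * v = 0 ->
  iter n (reflected_maxmin f g) D u v @[n --> \oo] --> (0 : R).
Proof.
move=> uv0; rewrite -(cvg_shiftS (fun n => iter n _ D u v)).
apply: cvg_near_cst; near=> n.
by rewrite /= /reflected_maxmin uv0 !mul0r.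
Unshelve. all: by end_near. Qed.

(** * The limit *)

Theorem theorem8 (R : realType) (C : R -> R -> R) (f g : R -> R)
    (alpha beta : R)
    (hC : copula C) (hf : generator f) (hg : generator g)
    (halpha : least (fixes_above f) alpha)
    (hbeta : least (fixes_above g) beta)
    (u v : R) (hu : u \in `[0, 1]) (hv : v \in `[0, 1]) :
  let Tn := fun n : nat => iter n (reflected_maxmin f g) (flip C) u v in
  [/\ (* NE *) alpha <= u -> beta <= v ->
        Tn n @[n --> \oo] --> flip C u v,
      (* SE *) alpha <= u -> v <= beta ->
        Tn n @[n --> \oo] --> v / beta * flip C u beta,
      (* NW *) u <= alpha -> beta <= v ->
        Tn n @[n --> \oo] --> u / alpha * flip C alpha v
    & (* SW *) u <= alpha -> v <= beta ->
        (f u * g v < u * v ->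
          exists2 p : R,
            infinite_product
              (fun k => 1 - star f (iter k (hat f) u)
                            * star g (iter k (hat g) v)) p
            & Tn n @[n --> \oo] -->
                u * v * (flip C alpha beta / (alpha * beta)) * p) /\
        (u * v <= f u * g v -> Tn n @[n --> \oo] --> (0 : R))].
Proof.
move=> Tn.
have hD : copula (flip C) by exact: flip_copula.
have a1 := alpha_le1 halpha; have b1 := alpha_le1 hbeta.
have [ia ib] : alpha \in `[0, 1] /\ beta \in `[0, 1].
  by case: halpha hbeta => -[? _] _ [[? _] _].
have [f0 g0] : f 0 = 0 /\ g 0 = 0 by case: hf hg => -[? _ _] _ _ [[? _ _] _ _].
have [uv0|uv0] := eqVneq (u * v) 0.
  have Tn0 : Tn n @[n --> \oo] --> (0 : R) by exact: iter_reflected_maxmin_axis.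
  case: hD => D0 _ _.
  split=> [_ _|_ _|_ _|_ _].
  - suff -> : flip C u v = 0 by [].
    by move/eqP: uv0; rewrite mulf_eq0 => /orP[] /eqP z; move: hu hv;
      rewrite z => ? ?; [apply: (D0 v _).2|apply: (D0 u _).1].
  - suff -> : v / beta * flip C u beta = 0 by [].
    move/eqP: uv0; rewrite mulf_eq0 => /orP[] /eqP ->; last by rewrite !mul0r.
    by rewrite (D0 _ ib).2 mulr0.
  - suff -> : u / alpha * flip C alpha v = 0 by [].
    move/eqP: uv0; rewrite mulf_eq0 => /orP[] /eqP ->; first by rewrite !mul0r.
    by rewrite (D0 _ ia).1 mulr0.
  - split=> [|_]; last exact: Tn0.
    rewrite uv0; move/eqP: uv0; rewrite mulf_eq0 => /orP[] /eqP ->.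
      by rewrite f0 mul0r ltxx.
    by rewrite g0 mulr0 ltxx.
have [un0 vn0] : u != 0 /\ v != 0.
  by move: uv0; rewrite mulf_eq0 negb_or => /andP[].
have u01 : 0 < u <= 1.
  by move: hu; rewrite in_itv /= => /andP[? ->]; rewrite lt_def un0 andbT.
have v01 : 0 < v <= 1.
  by move: hv; rewrite in_itv /= => /andP[? ->]; rewrite lt_def vn0 andbT.
have /andP[u0 u1] := u01; have /andP[v0 v1] := v01.
have ufix : alpha <= u -> star f u = 0 /\ forall n, iter n (hat f) u = u.
  move=> au; have au1 : alpha <= u <= 1 by rewrite au.
  by split=> [|n]; [exact: (star_alpha halpha)|exact: (orbit_alpha halpha)].
have vfix : beta <= v -> star g v = 0 /\ forall n, iter n (hat g) v = v.
  move=> bv; have bv1 : beta <= v <= 1 by rewrite bv.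
  by split=> [|n]; [exact: (star_alpha hbeta)|exact: (orbit_alpha hbeta)].
have ucvg ua := orbit_cvg hf halpha u01 ua.
have vcvg vb := orbit_cvg hg hbeta v01 vb.
have ole ua n := orbit_le_alpha hf halpha n u01 ua.
have vle vb n := orbit_le_alpha hg hbeta n v01 vb.
have cst (F : R -> R) (x : R) :
    (forall n, iter n F x = x) -> iter n F x @[n --> \oo] --> x.
  by move=> Fx; under eq_fun do rewrite Fx; exact: cvg_cst.
have cvgT a b p := @iter_reflected_maxmin_cvg R f g (flip C) u v a b p
  hf hg hD u01 v01.
split=> [au bv|au vb|ua bv|ua vb].
- have [su ou] := ufix au; have [sv ov] := vfix bv.
  have -> : flip C u v = u * v * (flip C u v / (u * v)) * 1.
    by rewrite mulr1 mulrC divfK.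
  apply: cvgT => //; rewrite ?su ?mul0r ?ltr01//.
  + by move=> n; rewrite ou.
  + by move=> n; rewrite ov.
  + exact: cst.
  + exact: cst.
  + by apply: infinite_product_1 => k; rewrite ou su mul0r subr0.
- have [su ou] := ufix au.
  have bn0 : beta != 0 by rewrite gt_eqF// (lt_le_trans v0).
  have -> : v / beta * flip C u beta
            = u * v * (flip C u beta / (u * beta)) * 1.
    by field; apply/andP; split.
  apply: cvgT => //; rewrite ?su ?mul0r ?ltr01//.
  + by move=> n; rewrite ou.
  + exact: vle.
  + exact: cst.
  + exact: vcvg.
  + by apply: infinite_product_1 => k; rewrite ou su mul0r subr0.
- have [sv ov] := vfix bv.
  have an0 : alpha != 0 by rewrite gt_eqF// (lt_le_trans u0).
  have -> : u / alpha * flip C alpha v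
            = u * v * (flip C alpha v / (alpha * v)) * 1.
    by field; apply/andP; split.
  apply: cvgT => //; rewrite ?sv ?mulr0 ?ltr01//.
  + exact: ole.
  + by move=> n; rewrite ov.
  + exact: ucvg.
  + exact: cst.
  + by apply: infinite_product_1 => k; rewrite ov sv mulr0 subr0.
- have starE : star f u * star g v = f u * g v / (u * v).
    by rewrite /star; field; apply/andP; split.
  have uvgt0 : 0 < u * v by rewrite mulr_gt0.
  split=> [lt1|ge1].
    have q1 : star f u * star g v < 1 by rewrite starE ltr_pdivrMr// mul1r.
    have [p hp] := orbit_prod_cvg hf hg u01 v01 q1.
    exists p => //; apply: cvgT => //.
    + exact: ole.
    + exact: vle.
    + exact: ucvg.
    + exact: vcvg.
  have q1 : 1 <= star f u * star g v by rewrite starE ler_pdivlMr// mul1r.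
  rewrite -(cvg_shiftS Tn); apply: cvg_near_cst; near=> n.
  by rewrite /Tn /= /reflected_maxmin max_l ?mulr0// subr_le0.
Unshelve. all: by end_near. Qed.
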